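(* Let $\Omega\subset\mathbb{T}$ be a bicomplex domain and let $\boldsymbol{F}$ be a family of bicomplex meromorphic functions in $\Omega$. Then $\boldsymbol{F}$ is normal in $\Omega$ if and only if $\boldsymbol{F}$ is bispherically equicontinuous in $\Omega$.
   Context: Bicomplex numbers: $\mathbb{T}=\{z_1+z_2\mathbf{i_2} : z_1,z_2\in\mathbb{C}(\mathbf{i_1})\}$, where $\mathbb{C}(\mathbf{i_1})=\{x+y\mathbf{i_1}: x,y\in\mathbb{R}\}$ is the field of complex numbers with imaginary unit $\mathbf{i_1}$, $\mathbf{i_1}^2=\mathbf{i_2}^2=-1$, $\mathbf{i_1}\mathbf{i_2}=\mathbf{i_2}\mathbf{i_1}=\mathbf{j}$, $\mathbf{j}^2=1$; $\mathbb{T}$ is identified with $\mathbb{R}^4$ and $\|\cdot\|$ is the Euclidean norm. The projections $\mathcal{P}_1,\mathcal{P}_2:\mathbb{T}\to\mathbb{C}(\mathbf{i_1})$ are $\mathcal{P}_1(z_1+z_2\mathbf{i_2})=z_1-z_2\mathbf{i_1}$, $\mathcal{P}_2(z_1+z_2\mathbf{i_2})=z_1+z_2\mathbf{i_1}$. With $\mathbf{e_1}=(1+\mathbf{j})/2$, $\mathbf{e_2}=(1-\mathbf{j})/2$, every $w\in\mathbb{T}$ is uniquely $w=\mathcal{P}_1(w)\mathbf{e_1}+\mathcal{P}_2(w)\mathbf{e_2}$, and the ring operations act componentwise. A domain is a nonempty open connected set. Extended bicomplex plane: $\overline{\mathbb{T}}$ is the set of all formal $w=w_1\mathbf{e_1}+w_2\mathbf{e_2}$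 with $w_1,w_2\in\overline{\mathbb{C}(\mathbf{i_1})}=\mathbb{C}(\mathbf{i_1})\cup\{\infty\}$; $\mathcal{P}_i(w)=w_i$ extends the projections to $\overline{\mathbb{T}}$. Chordal metrics: $\chi$ is the chordal metric on $\overline{\mathbb{C}(\mathbf{i_1})}$, $\chi(a,b)=\frac{|a-b|}{\sqrt{1+|a|^2}\sqrt{1+|b|^2}}$ for finite $a,b$, $\chi(a,\infty)=\frac{1}{\sqrt{1+|a|^2}}$ for finite $a$, $\chi(\infty,\infty)=0$. The bicomplex chordal metric on $\overline{\mathbb{T}}$ is $\chi_e(z,w)=\sqrt{\frac{\chi^2(\mathcal{P}_1(z),\mathcal{P}_1(w))+\chi^2(\mathcal{P}_2(z),\mathcal{P}_2(w))}{2}}$. Bicomplex meromorphic functions: a function $f$ on an open set $\Omega\subset\mathbb{T}$ (with values in $\overline{\mathbb{T}}$) is bicomplex meromorphic if there are meromorphic functions $f_{e1}$ on $\mathcal{P}_1(\Omega)$ and $f_{e2}$ on $\mathcal{P}_2(\Omega)$ (taking the value $\infty$ at their poles) such that $f(w)=f_{e1}(\mathcal{P}_1(w))\mathbf{e_1}+f_{e2}(\mathcal{P}_2(w))\mathbf{e_2}$ for all $w\in\Omega$. Normality: a sequence $\{f_n\}$ of $\overline{\mathbb{T}}$-valued functions converges bispherically uniformly to $f$ on a set $E$ if for every $\epsilon>0$ there is $n_0$ with $\chi_e(f_n(w),f(w))<\epsilon$ for all $n\ge n_0$ and $w\in E$. A family $\boldsymbol{F}$ of bicomplex meromorphic functions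 in $\Omega$ is normal in $\Omega$ if every sequence in $\boldsymbol{F}$ contains a subsequence which converges bispherically uniformly on compact subsets of $\Omega$ (to some $\overline{\mathbb{T}}$-valued function). Bispherical equicontinuity: $\boldsymbol{F}$ is bispherically equicontinuous at $w_0\in\Omega$ if for each $\epsilon>0$ there is $\delta=\delta(\epsilon,w_0)>0$ such that $\chi_e(f(w),f(w_0))<\epsilon$ whenever $\|w-w_0\|<\delta$ (with $w\in\Omega$), for all $f\in\boldsymbol{F}$. It is bispherically equicontinuous in $\Omega$ if it is so at each point of $\Omega$. *)

(* Defs.v *)
From mathcomp Require Import all_boot all_order all_algebra.
From mathcomp Require Import all_classical all_reals all_analysis.
From mathcomp Require Import complex.

Set Implicit Arguments.
Unset Strict Implicit.
Unset Printing Implicit Defensive.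

Import Order.TTheory GRing.Theory Num.Theory.
Import numFieldNormedType.Exports.

Local Open Scope classical_set_scope.
Local Open Scope ring_scope.

(* C(i1).  The alias _^o carries the usual topology of R[i] and its structure
   of one-dimensional normed module over itself, so that [derivable f z 1] is
   complex differentiability at z. *)
Notation cplx R := (R[i]^o).

(* C(i1) with a point at infinity; None is infinity. *)
Definition ecplx (R : realType) := option (cplx R).

(* The value infinity is sent to 0. *)
Definition finite_part (R : realType) (a : ecplx R) : cplx R := odflt 0 a.

Definition modulus (R : realType) (z : cplx R) : R := ComplexField.Normc.normc z.

(* The pair (z1, z2) stands for z1 + z2 i2.  Only the additive group and the
   topology of the product type are those of the bicomplex numbers: its ring
   structure is componentwise in (z1, z2), and its norm is the maximum norm. *)
Notation bicomplex R := (cplx R * cplx R)%type.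

Definition bnorm (R : realType) (w : bicomplex R) : R :=
  Num.sqrt (modulus w.1 ^+ 2 + modulus w.2 ^+ 2).

Definition idem_proj1 (R : realType) (w : bicomplex R) : cplx R :=
  w.1 - w.2 * 'i%C.

Definition idem_proj2 (R : realType) (w : bicomplex R) : cplx R :=
  w.1 + w.2 * 'i%C.

(* The pair (w1, w2) stands for w1 e1 + w2 e2: unlike those of [bicomplex],
   these are the idempotent coordinates, and the extended projections are
   [fst] and [snd]. *)
Definition ebicomplex (R : realType) := (ecplx R * ecplx R)%type.

Definition chordal (R : realType) (a b : ecplx R) : R :=
  match a, b with
  | Some a, Some b => modulus (a - b) /
      (Num.sqrt (1 + modulus a ^+ 2) * Num.sqrt (1 + modulus b ^+ 2))
  | Some a, None => 1 / Num.sqrt (1 + modulus a ^+ 2)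
  | None, Some b => 1 / Num.sqrt (1 + modulus b ^+ 2)
  | None, None => 0
  end.

Definition bichordal (R : realType) (z w : ebicomplex R) : R :=
  Num.sqrt ((chordal z.1 w.1 ^+ 2 + chordal z.2 w.2 ^+ 2) / 2).

Definition holomorphic_near (R : realType) (f : cplx R -> ecplx R)
    (G : set_system (cplx R)) : Prop :=
  \forall z \near G,
    f z <> None /\ derivable (fun y : cplx R => finite_part (f y)) z 1.

Definition is_pole (R : realType) (f : cplx R -> ecplx R) (p : cplx R) : Prop :=
  [/\ f p = None, holomorphic_near f p^' &
      modulus (finite_part (f z)) @[z --> p^'] --> +oo].

(* On an open set U, holomorphic off a set of isolated points, each of which is
   a pole; the values outside U play no role. *)
Definition meromorphic (R : realType) (U : set (cplx R))
    (f : cplx R -> ecplx R) : Prop :=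
  forall z, U z -> holomorphic_near f (nbhs z) \/ is_pole f z.

Definition bimeromorphic (R : realType) (Omega : set (bicomplex R))
    (f : bicomplex R -> ebicomplex R) : Prop :=
  exists f1 f2 : cplx R -> ecplx R,
    [/\ meromorphic (@idem_proj1 R @` Omega) f1,
        meromorphic (@idem_proj2 R @` Omega) f2 &
        forall w, Omega w -> f w = (f1 (idem_proj1 w), f2 (idem_proj2 w))].

Definition bicomplex_domain (R : realType) (Omega : set (bicomplex R)) : Prop :=
  [/\ Omega !=set0, open Omega & connected Omega].

Definition bispherical_cvg_on (R : realType) (E : set (bicomplex R))
    (u : nat -> bicomplex R -> ebicomplex R)
    (f : bicomplex R -> ebicomplex R) : Prop :=
  forall eps : R, 0 < eps -> exists n0 : nat,
    forall n w, (n0 <= n)%N -> E w -> bichordal (u n w) (f w) < eps.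

Definition normal_family (R : realType) (Omega : set (bicomplex R))
    (F : set (bicomplex R -> ebicomplex R)) : Prop :=
  forall u : nat -> bicomplex R -> ebicomplex R, (forall n, F (u n)) ->
  exists phi : nat -> nat, {homo phi : m n / (m < n)%N} /\
  exists f : bicomplex R -> ebicomplex R,
    forall K : set (bicomplex R), compact K -> K `<=` Omega ->
      bispherical_cvg_on K (u \o phi) f.

Definition bispherically_equicontinuous_at (R : realType)
    (Omega : set (bicomplex R)) (F : set (bicomplex R -> ebicomplex R))
    (w0 : bicomplex R) : Prop :=
  forall eps : R, 0 < eps -> exists2 delta : R, 0 < delta &
    forall f w, F f -> Omega w -> bnorm (w - w0) < delta ->
      bichordal (f w) (f w0) < eps.

Definition bispherically_equicontinuous (R : realType)
    (Omega : set (bicomplex R)) (F : set (bicomplex R -> ebicomplex R)) : Prop :=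
  forall w0, Omega w0 -> bispherically_equicontinuous_at Omega F w0.

(* Main.v *)
Require Import Defs.
From mathcomp Require Import all_boot all_order all_algebra.
From mathcomp Require Import all_classical all_reals all_analysis.
From mathcomp Require Import complex ring lra.

Set Implicit Arguments.
Unset Strict Implicit.
Unset Printing Implicit Defensive.

Import Order.TTheory GRing.Theory Num.Theory.
Import numFieldNormedType.Exports.

Local Open Scope classical_set_scope.
Local Open Scope ring_scope.

(** The theorem is the Arzela-Ascoli theorem.  Stereographic projection embeds
    the extended complex plane in R^3 with the unit-diameter sphere as image,
    and the chordal metric becomes the Euclidean distance ([chordal_sqr],
    [range_stereo]).  Hence [bistereo] turns functions with values in the
    extended bicomplex plane into functions with values in a product of two
    spheres, which is compact ([compact_range_bistereo]), and bichordal
    smallness is smallness of the six coordinates ([bichordal_lt],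
    [ball_bistereo]).

    Equicontinuous families are normal ([ascoli_seq]): along an ultrafilter on
    the indices, finer than the filter of neighbourhoods of infinity, every
    sequence converges pointwise everywhere, because the target is compact.
    The members of the ultrafilter are unbounded sets of indices, so a
    subsequence can be chosen whose m-th term is within 1/(m+1) of the limit at
    the first m points of a dense sequence.  Equicontinuity propagates this
    approximation to a neighbourhood of every point of the domain, and locally
    uniform convergence is uniform convergence on compact sets.

    Normal families are equicontinuous ([normal_equicontinuous_at]): otherwise
    there are members f_n and points w_n tending to w_0 at which f_n(w_n) stays
    away from f_n(w_0).  The points w_n and w_0 form a compact set
    ([compact_cvg_seq]), on which a subsequence of f_n is uniformly close to
    one of its members, and the continuity of that member at w_0 gives a
    contradiction.  This half needs every member of the family to be continuous
    for the bichordal metric, which is where meromorphy enters: at a point of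
    holomorphy the chordal distance is at most the distance, and at a pole
    the modulus tends to infinity ([meromorphic_chordal_continuous]). *)

(** * Normality and equicontinuity for functions into a pseudometric space *)

Lemma compact_cvg_seq (T : topologicalType) (w : nat -> T) (x : T) :
  w @ \oo --> x -> compact (x |` range w).
Proof.
move=> wx; apply/compact_near_coveringP => I F P FF xwP.
have [[A B] /= [xA FB] ABP] := xwP x (or_introl erefl).
have [N _ NA] := wx A xA.
have finP : forall n : nat, \forall i \near F, forall k, (k < n)%N -> P i (w k).
  elim=> [|n IHn]; first by near=> i.
  have [//|[A' B'] /= [wA' FB'] AB'] := xwP (w n); first by right; exists n.
  near=> i => k; rewrite ltnS leq_eqVlt => /orP[/eqP ->|kn].
    apply: (AB' (w n, i)); split => /=; first exact: nbhs_singleton.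
    by near: i.
  by move: k kn; near: i.
near=> i => y [->|[k _ <-]].
  by apply: (ABP (x, i)); split => /=; [exact: nbhs_singleton|near: i].
have [kN|Nk] := ltnP k N; first by move: k kN; near: i; exact: finP.
by apply: (ABP (w k, i)); split => /=; [exact: NA|near: i].
Unshelve. all: by end_near. Qed.

Section Ascoli.
Context {R : realType} {T : topologicalType} {Y : pseudoMetricType R}.
Implicit Types (Omega : set T) (G : set (T -> Y)).

Definition equicontinuous_on Omega G :=
  forall x, Omega x -> forall e : R, 0 < e ->
    \forall y \near x, forall g, G g -> Omega y -> ball (g x) e (g y).

Definition subseq_unif_on_compacts Omega (u : nat -> T -> Y) (f : T -> Y) :=
  exists2 phi : nat -> nat, {homo phi : m n / (m < n)%N} &
  forall K, compact K -> K `<=` Omega -> forall e : R, 0 < e ->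
    \forall n \near \oo, forall w, K w -> ball (f w) e (u (phi n) w).

(** This is what extracting a subsequence amounts to once each requirement on
    its terms is met by arbitrarily large indices. *)
Lemma ex_strict_selection (S : nat -> set nat) :
    (forall m N, exists2 n, (N <= n)%N & S m n) ->
  exists2 phi : nat -> nat, {homo phi : m n / (m < n)%N} & forall m, S m (phi m).
Proof.
move=> Sunb.
have [s sP] : {s : nat * nat -> nat & forall p, (p.2 <= s p)%N /\ S p.1 (s p)}.
  apply: (@choice _ _ (fun p n => (p.2 <= n)%N /\ S p.1 n)) => p.
  by have [n] := Sunb p.1 p.2; exists n.
pose phi := fix phi m :=
  if m is m'.+1 then s (m'.+1, (phi m').+1) else s (0, 0)%N.
exists phi; last by case=> [|m] /=; exact: (sP (_, _)).2.
apply: homo_ltn => [m n p|m]; first exact: ltn_trans.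
exact: (sP (_, _)).1.
Qed.

(** The ultrafilter replaces the diagonal argument: it gives the limit at all
    points at once, and the dense sequence only serves to choose the
    subsequence.  Near [x], the chain
    f y ~ f x ~ f (d k) ~ u_n (d k) ~ u_n x ~ u_n y compares the limit and the
    terms, and how large [n] must be is decided by the link at [d k] alone. *)
Lemma ascoli_seq Omega (d : nat -> T) (C : set Y) (u : nat -> T -> Y) :
    open Omega ->
    dense (range d) ->
    compact C -> (forall n x, C (u n x)) ->
    equicontinuous_on Omega (range u) ->
  exists2 f : T -> Y, (forall x, C (f x)) & subseq_unif_on_compacts Omega u f.
Proof.
move=> oOm d_dense cC uC ueq.
have [U [UU oo_U]] := @ultraFilterLemma nat \oo _.
have [f fP] : {f : T -> Y & forall x, C (f x) /\ u ^~ x @ U --> f x}.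
  apply: (@choice _ _ (fun x p => C p /\ u ^~ x @ U --> p)) => x.
  have [p [Cp clp]] := cC (u ^~ x @ U) _ (filterE _ (uC ^~ x)).
  exists p; split=> // A pA.
  have [//|UAc] := in_ultra_setVsetC (u ^~ x @^-1` A) UU.
  have [y [yAc yA]] : (~` A) `&` A !=set0 by exact: clp.
  by case: yAc.
exists f; first by move=> x; exact: (fP x).1.
pose S m := [set n | forall k, (k < m)%N ->
  ball (f (d k)) (m.+1%:R^-1 : R) (u n (d k))].
have US m : U (S m).
  rewrite /S; move: (m.+1%:R^-1 : R) (invr_gt0 (m.+1%:R : R)) => e.
  rewrite ltr0Sn => e0.
  change (\forall n \near U, forall k, (k < m)%N -> ball (f (d k)) e (u n (d k))).
  elim: m => [|j IHj]; first by near=> n.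
  near=> n => k; rewrite ltnS leq_eqVlt => /orP[/eqP ->|kj].
    by near: n; apply: (fP (d j)).2; exact: nbhsx_ballx.
  by move: k kj; near: n.
have [m N|phi phi_inc phiS] := @ex_strict_selection S.
  have SN : U (S m `&` [set n | (N <= n)%N]).
    by apply: filterI; [exact: US|exact: oo_U (nbhs_infty_ge N)].
  by have [n [Sn Nn]] := @filter_ex _ U _ _ SN; exists n.
exists phi => // K /compact_near_coveringP cK KOm e e0.
apply: cK => x Kx; have Omx := KOm x Kx.
(* nine links: three for each of f y ~ f x and f x ~ f (d k), one for each of
   the other three *)
pose s := e / 9; have s0 : 0 < s by rewrite divr_gt0.
have : nbhs x (Omega `&`
    [set y | forall g, range u g -> Omega y -> ball (g x) s (g y)]).
  by apply: filterI; [exact: open_nbhs_nbhs|exact: ueq].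
rewrite nbhsE => -[W [oW xW] WP].
have uW n y : W y -> ball (u n x) s (u n y).
  by move=> /WP[Omy]; apply => //; exists n.
(* the oscillation bound on [W] passes to the pointwise limit *)
have fW y : W y -> ball (f x) (s + (s + s)) (f y).
  move=> Wy.
  have [n [xn yn]] : exists n, ball (f x) s (u n x) /\ ball (f y) s (u n y).
    apply: (@filter_ex _ U).
    by near=> n; split; near: n; apply: (fP _).2; exact: nbhsx_ballx.
  by apply: ball_triangle xn (ball_triangle (uW n y Wy) (ball_sym yn)).
have [k Wk] : exists k, W (d k).
  have [y [Wy [k _ dk]]] := d_dense W (ex_intro _ x xW) oW.
  by exists k; rewrite dk.
near=> y n.
have Wy : W y by near: y; exact: open_nbhs_nbhs.
have eE : (s + (s + s)) + ((s + (s + s)) + (s + (s + s))) = e by rewrite /s; lra.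
rewrite -eE.
apply: ball_triangle (ball_sym (fW y Wy)) (ball_triangle (fW _ Wk) _).
apply: ball_triangle _ (ball_triangle (ball_sym (uW _ _ Wk)) (uW _ _ Wy)).
apply: (@le_ball _ _ _ (n.+1%:R^-1)).
  by apply: ltW; near: n; exact: (near_infty_natSinv_lt (PosNum s0)).
apply: phiS; near: n; exact: nbhs_infty_gt.
Unshelve. all: by end_near. Qed.

(** The countable base [V] of neighbourhoods of [x] turns a failure of
    equicontinuity into a sequence of functions and points. *)
Lemma normal_equicontinuous_at (x : T) (V : nat -> set T) Omega G :
    Omega x ->
    (forall n, nbhs x (V n)) ->
    (forall A, nbhs x A -> \forall n \near \oo, V n `<=` A) ->
    (forall g, G g -> forall e : R, 0 < e ->
      \forall y \near x, Omega y -> ball (g x) e (g y)) ->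
    (forall u : nat -> T -> Y, (forall n, G (u n)) ->
      exists f, subseq_unif_on_compacts Omega u f) ->
  forall e : R, 0 < e ->
    \forall y \near x, forall g, G g -> Omega y -> ball (g x) e (g y).
Proof.
move=> Omx xV Vx Gcont Gnorm e e0; apply: contrapT => neq.
have [p pP] : {p : nat -> (T -> Y) * T & forall n, [/\ G (p n).1, Omega (p n).2,
    V n (p n).2 & ~ ball ((p n).1 x) e ((p n).1 (p n).2)]}.
  apply: (@choice _ _ (fun n (q : (T -> Y) * T) => [/\ G q.1, Omega q.2,
    V n q.2 & ~ ball (q.1 x) e (q.1 q.2)])) => n.
  apply: contrapT => nq; apply: neq; apply: filterS (xV n) => y Vy g Gg Omy.
  by apply: contrapT => nb; apply: nq; exists (g, y).
pose w n := (p n).2.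
have wx : w @ \oo --> x.
  by move=> A /Vx; apply: filterS => n; apply; have [] := pP n.
have Gp n : G (p n).1 by have [] := pP n.
have [f [phi phi_inc]] := Gnorm (fun n => (p n).1) Gp.
have KOm : x |` range w `<=` Omega.
  by move=> _ [->//|[n _ <-]]; have [] := pP n.
(* compare the n-th term with the fixed N-th one, continuous at [x], each through
   the limit *)
pose s := e / 5; have s0 : 0 < s by rewrite divr_gt0.
move=> /(_ _ (compact_cvg_seq wx) KOm s s0)[N _ NP].
have near_eq : \forall n \near \oo, Omega (w n) ->
    ball ((p (phi N)).1 x) s ((p (phi N)).1 (w n)).
  exact: (wx _ (Gcont _ (Gp (phi N)) s s0)).
have [M _ MP] := near_eq.
have phi_ge n : (n <= phi n)%N.
  by elim: n => // n IHn; apply: leq_ltn_trans IHn (phi_inc _ _ _).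
pose n := maxn M N; have [_ Omn _] := pP (phi n); apply.
have xK : (x |` range w) x by left.
have wK : (x |` range w) (w (phi n)) by right; exists (phi n).
have nN : (N <= n)%N by exact: leq_maxr.
have eE : ((s + s) + s) + (s + s) = e by rewrite /s; lra.
rewrite -eE; apply: (ball_triangle (y := (p (phi N)).1 (w (phi n)))).
  apply: (ball_triangle (y := (p (phi N)).1 x)).
    exact: (ball_triangle (ball_sym (NP n nN x xK)) (NP N (leqnn N) x xK)).
  apply: MP => //=; exact: leq_trans (leq_maxl _ _) (phi_ge n).
exact: (ball_triangle (ball_sym (NP N (leqnn N) _ wK)) (NP n nN _ wK)).
Qed.

End Ascoli.

(** * The topology of the bicomplex numbers *)

Section Bicomplex.
Context {R : realType}.
Implicit Types (a b z : cplx R) (w : bicomplex R).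

Lemma modulus_ge0 z : 0 <= modulus z.
Proof. by case: z => x y; exact: sqrtr_ge0. Qed.

Lemma modulus_sqr z : modulus z ^+ 2 = complex.Re z ^+ 2 + complex.Im z ^+ 2.
Proof. by case: z => x y; rewrite sqr_sqrtr // addr_ge0 ?sqr_ge0. Qed.

Lemma normc_modulus z : `|z| = (modulus z)%:C%C.
Proof. by case: z. Qed.

(** The radii of the balls of the normed space are positive elements of R[i],
    that is, positive reals. *)
Lemma nbhs_modulusP z (A : set (cplx R)) :
  nbhs z A <-> exists2 e : R, 0 < e & forall y, modulus (y - z) < e -> A y.
Proof.
rewrite -nbhs_ballE; split=> [[e /= e0 eA]|[e e0 eA]].
  case: e e0 eA => e e'; rewrite ltcE /= => /andP[/eqP ->] e0 eA.
  exists e => // y ye; apply: eA; rewrite -ball_normE /ball_ /= distrC.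
  by rewrite normc_modulus ltcE /= eqxx.
exists (e%:C)%C; first by rewrite /= ltcE /= eqxx.
move=> y; rewrite -ball_normE /ball_ /= distrC normc_modulus ltcE /= eqxx => ye.
exact: eA.
Qed.

Lemma lt_sqrtr2 (x e : R) : 0 < e -> x < e ^+ 2 -> Num.sqrt x < e.
Proof.
move=> e0 xe; rewrite -[e in _ < e]ger0_norm ?ltW// -sqrtr_sqr ltr_sqrt//.
by rewrite exprn_gt0.
Qed.

Lemma bnorm_lt w (e : R) : modulus w.1 < e -> modulus w.2 < e ->
  bnorm w < 2 * e.
Proof.
move=> w1 w2; have := modulus_ge0 w.1; have := modulus_ge0 w.2 => p1 p2.
apply: lt_sqrtr2; first by lra.
by nra.
Qed.

Lemma modulus_le_bnorm w : modulus w.1 <= bnorm w /\ modulus w.2 <= bnorm w.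
Proof.
have le_sqrt (x y : R) : 0 <= x -> x ^+ 2 <= y -> x <= Num.sqrt y.
  by move=> x0 xy; rewrite -[x]ger0_norm// -sqrtr_sqr ler_wsqrtr.
by split; apply: le_sqrt; rewrite ?modulus_ge0 // ?lerDl ?lerDr sqr_ge0.
Qed.

Lemma nbhs_bnormP w (A : set (bicomplex R)) :
  nbhs w A <-> exists2 e : R, 0 < e & forall y, bnorm (y - w) < e -> A y.
Proof.
split.
  move=> [[P Q] /= [/nbhs_modulusP[e e0 eP] /nbhs_modulusP[e' e'0 eQ]] PQ].
  exists (Num.min e e'); first by rewrite lt_min e0.
  move=> y; rewrite lt_min => /andP[ye ye'].
  have [y1 y2] := modulus_le_bnorm (y - w).
  apply: PQ; split=> /=.
    by apply: eP; exact: le_lt_trans y1 ye.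
  by apply: eQ; exact: le_lt_trans y2 ye'.
move=> [e e0 eA].
pose D z : set (cplx R) := [set y | modulus (y - z) < e / 2].
have D_nbhs z : nbhs z (D z).
  by apply/nbhs_modulusP; exists (e / 2); rewrite ?divr_gt0.
exists (D w.1, D w.2); first by split; exact: D_nbhs.
move=> y [y1 y2]; apply: eA.
have -> : e = 2 * (e / 2) by lra.
exact: bnorm_lt.
Qed.

Lemma idem_proj1_continuous : continuous (@idem_proj1 R).
Proof.
move=> w; apply: cvgB; first exact: cvg_fst.
by apply: cvgM; [exact: cvg_snd|exact: cvg_cst].
Qed.

Lemma idem_proj2_continuous : continuous (@idem_proj2 R).
Proof.
move=> w; apply: cvgD; first exact: cvg_fst.
by apply: cvgM; [exact: cvg_snd|exact: cvg_cst].
Qed.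

Lemma ex_dense_seq : exists d : nat -> bicomplex R, dense (range d).
Proof.
pose point (q : (rat * rat) * (rat * rat)) : bicomplex R :=
  (((ratr q.1.1) +i* (ratr q.1.2))%C, ((ratr q.2.1) +i* (ratr q.2.2))%C).
exists (fun k => point (odflt ((0, 0), (0, 0)) (unpickle k))) => A [w Aw] oA.
have /nbhs_bnormP[e e0 eA] : nbhs w A by exact: open_nbhs_nbhs.
have approx (x : R) : exists q : rat, `|ratr q - x| < e / 4.
  have [|q] := @rat_in_itvoo R (x - e / 4) (x + e / 4); first by lra.
  by rewrite in_itv /= => /andP[? ?]; exists q; rewrite ltr_norml; lra.
have approxC z : exists q : rat * rat,
    modulus (((ratr q.1) +i* (ratr q.2))%C - z) < e / 2.
  case: z => x y; have [p xp] := approx x; have [q yq] := approx y.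
  exists (p, q); apply: lt_sqrtr2; first by lra.
  rewrite -real_normK ?num_real // -[X in _ + X < _]real_normK ?num_real //.
  have := normr_ge0 (ratr p - x); have := normr_ge0 (ratr q - y); nra.
have [q1 wq1] := approxC w.1; have [q2 wq2] := approxC w.2.
exists (point (q1, q2)); split; last first.
  by exists (pickle (q1, q2)); rewrite ?pickleK.
apply: eA.
have -> : e = 2 * (e / 2) by lra.
exact: bnorm_lt.
Qed.

(** * Continuity of meromorphic functions for the chordal metric *)

Lemma chordal_le_modulus a b : chordal (Some a) (Some b) <= modulus (a - b).
Proof.
have sq1 z : 1 <= Num.sqrt (1 + modulus z ^+ 2).
  by rewrite -[X in X <= _]sqrtr1 ler_wsqrtr // lerDl sqr_ge0.
rewrite /= ler_pdivrMr; last by rewrite mulr_gt0 ?(lt_le_trans ltr01).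
by rewrite ler_peMr ?modulus_ge0 // mulr_ege1.
Qed.

Lemma chordal_infty_lt a (e : R) : 0 < e -> e^-1 < modulus a ->
  chordal (Some a) None < e.
Proof.
move=> e0 ea; have a0 : 0 < modulus a by apply: lt_trans ea; rewrite invr_gt0.
rewrite /= div1r -[ltRHS]invrK ltf_pV2 ?posrE ?invr_gt0//; last first.
  by rewrite sqrtr_gt0 addr_gt0 // exprn_gt0.
apply: lt_trans ea _; rewrite -[ltLHS]ger0_norm ?ltW// -sqrtr_sqr ltr_sqrt.
  by rewrite ltrDr.
by rewrite addr_gt0 // exprn_gt0.
Qed.

(** At a pole the values on a punctured neighbourhood are compared with
    infinity, by [chordal_infty_lt]. *)
Lemma meromorphic_chordal_continuous (U : set (cplx R))
    (f : cplx R -> ecplx R) z :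
    meromorphic U f -> U z ->
  forall e : R, 0 < e -> \forall y \near z, chordal (f y) (f z) < e.
Proof.
move=> fU Uz e e0; have [hol|[fz hol pole]] := fU z Uz.
  have [fz fz'] := nbhs_singleton hol.
  have /differentiable_continuous fc := (derivable1_diffP _ _).1 fz'.
  have fe : nbhs (finite_part (f z))
      [set a | modulus (a - finite_part (f z)) < e].
    by apply/nbhs_modulusP; exists e.
  near=> y.
  have [fy _] : f y <> None /\ derivable (fun y => finite_part (f y)) y 1.
    by near: y.
  have : modulus (finite_part (f y) - finite_part (f z)) < e.
    by near: y; exact: (fc _ fe).
  case: (f y) fy => // a _; case: (f z) fz => // b _ /=.
  exact: le_lt_trans (chordal_le_modulus a b).
have big : \forall y \near z^', e^-1 < modulus (finite_part (f y)).
  by apply: (pole [set x | e^-1 < x]); apply: nbhs_pinfty_gt; exact: num_real.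
have punctured : \forall y \near z, y != z -> chordal (f y) (f z) < e.
  change (z^' [set y | chordal (f y) (f z) < e]).
  apply: (@filterS2 _ z^' _ _ _ _ _ hol big) => y [fy _] yb.
  rewrite /= fz; case: (f y) fy yb => // a _.
  exact: chordal_infty_lt.
apply: filterS punctured => y yz; have [->|] := eqVneq y z; last exact: yz.
by rewrite fz.
Unshelve. all: by end_near. Qed.

Lemma bimeromorphic_bichordal_continuous (Omega : set (bicomplex R)) f w :
    bimeromorphic Omega f -> Omega w ->
  forall e : R, 0 < e -> \forall y \near w, Omega y -> bichordal (f y) (f w) < e.
Proof.
move=> [f1 [f2 [mf1 mf2 fE]]] Ow e e0.
have c1 := idem_proj1_continuous
  (meromorphic_chordal_continuous mf1 (ex_intro2 _ _ w Ow erefl) e0).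
have c2 := idem_proj2_continuous
  (meromorphic_chordal_continuous mf2 (ex_intro2 _ _ w Ow erefl) e0).
have chordal_ge0 (a b : ecplx R) : 0 <= chordal a b.
  case: a b => [a|] [b|] //=; rewrite divr_ge0 ?mulr_ge0 ?sqrtr_ge0 //.
  exact: modulus_ge0.
near=> y => Oy; rewrite !fE //; apply: lt_sqrtr2 => //=.
have : chordal (f1 (idem_proj1 y)) (f1 (idem_proj1 w)) < e.
  by near: y; exact: c1.
have : chordal (f2 (idem_proj2 y)) (f2 (idem_proj2 w)) < e.
  by near: y; exact: c2.
move: (chordal_ge0 (f1 (idem_proj1 y)) (f1 (idem_proj1 w))).
move: (chordal_ge0 (f2 (idem_proj2 y)) (f2 (idem_proj2 w))).
set a := chordal _ _; set b := chordal _ _ => a0 b0 ae be; nra.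
Unshelve. all: by end_near. Qed.

(** * Stereographic projection *)

(** Inverse stereographic projection onto the sphere of diameter 1 that touches
    the plane at the origin; infinity is sent to the north pole. *)
Definition stereo (a : ecplx R) : R * R * R :=
  if a is Some z then
    let m := complex.Re z ^+ 2 + complex.Im z ^+ 2 in
    (complex.Re z / (1 + m), complex.Im z / (1 + m), m / (1 + m))
  else (0, 0, 1).

Lemma chordal_sqr (a b : ecplx R) : chordal a b ^+ 2 =
  ((stereo a).1.1 - (stereo b).1.1) ^+ 2 + ((stereo a).1.2 - (stereo b).1.2) ^+ 2
  + ((stereo a).2 - (stereo b).2) ^+ 2.
Proof.
have pos (x y : R) : 0 < 1 + (x ^+ 2 + y ^+ 2).
  by rewrite ltr_wpDr // addr_ge0 // sqr_ge0.
case: a b => [[x y]|] [[x' y']|]; rewrite /chordal ?modulus_sqr /=.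
- rewrite expr_div_n exprMn !sqr_sqrtr ?addr_ge0 ?sqr_ge0 ?ler01 //.
  by field; rewrite !gt_eqF.
- rewrite expr_div_n sqr_sqrtr ?(ltW (pos _ _))//.
  by field; rewrite !gt_eqF.
- rewrite expr_div_n sqr_sqrtr ?(ltW (pos _ _))//.
  by field; rewrite !gt_eqF.
- by ring.
Qed.

(** The equation x^2 + y^2 + (t - 1/2)^2 = 1/4, freed of denominators. *)
Definition sphere : set (R * R * R) :=
  [set p | p.1.1 ^+ 2 + p.1.2 ^+ 2 = p.2 * (1 - p.2)].

Lemma range_stereo : range stereo = sphere.
Proof.
apply/seteqP; split=> [_ [[[x y]|] _ <-]|[[x y] t]]; rewrite /sphere /=.
- have pos : 0 < 1 + (x ^+ 2 + y ^+ 2) by rewrite ltr_wpDr // addr_ge0 // sqr_ge0.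
  by field; rewrite gt_eqF.
- by ring.
have [->|t1] := eqVneq t 1.
  rewrite subrr mulr0 => /eqP; rewrite paddr_eq0 ?sqr_ge0 // !sqrf_eq0.
  by move=> /andP[/eqP -> /eqP ->]; exists None.
have t1' : 1 - t != 0 by rewrite subr_eq0 eq_sym.
move=> xyt; exists (Some ((x / (1 - t)) +i* (y / (1 - t)))%C) => //=.
have -> : (x / (1 - t)) ^+ 2 + (y / (1 - t)) ^+ 2 = t / (1 - t).
  by rewrite !expr_div_n -mulrDl xyt; field.
by congr (_, _, _); field; rewrite t1' ?subrK ?addrNK ?oner_neq0.
Qed.

Lemma compact_sphere : compact sphere.
Proof.
pose I := `[(-1 : R), 1]%classic.
have cI : compact I by exact: segment_compact.
apply: (subclosed_compact _ (compact_setX (compact_setX cI cI) cI)).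
  have -> : sphere = (fun p : R * R * R =>
      p.1.1 ^+ 2 + p.1.2 ^+ 2 - p.2 * (1 - p.2)) @^-1` [set 0].
    apply/seteqP; split=> p; rewrite /sphere /=.
      by move=> ->; rewrite subrr.
    by move=> /eqP; rewrite subr_eq0 => /eqP.
  apply: preimage_closed; last exact: closed_eq.
  move=> p _; apply: cvgB; last first.
    by apply: cvgM; [exact: cvg_snd|apply: cvgB; [exact: cvg_cst|exact: cvg_snd]].
  have fst_cvg : q.1 @[q --> p] --> p.1 by exact: cvg_fst.
  have sqr_cvg (g : R * R * R -> R) :
      g q @[q --> p] --> g p -> g q ^+ 2 @[q --> p] --> g p ^+ 2.
    by move=> gp; rewrite expr2; apply: cvgM.
  apply: cvgD; apply: sqr_cvg.
    exact: (cvg_comp _ _ fst_cvg cvg_fst).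
  exact: (cvg_comp _ _ fst_cvg cvg_snd).
move=> [[x y] t]; rewrite /sphere /I /= => xyt.
(* the sphere has radius 1/2 and centre (0, 0, 1/2) *)
have x2 := sqr_ge0 x; have y2 := sqr_ge0 y; have t2 := sqr_ge0 (t - 1 / 2).
have bound (z : R) : z ^+ 2 <= 1 -> -1 <= z <= 1.
  move=> z1; rewrite -ler_norml -(@ler_pXn2r _ 2) ?nnegrE //.
  by rewrite real_normK ?num_real // expr1n.
rewrite /setX /= !in_itv /=; do 2?split; apply: bound; nra.
Qed.

Definition bistereo (w : ebicomplex R) : (R * R * R) * (R * R * R) :=
  (stereo w.1, stereo w.2).

(** Since [bichordal] is the Euclidean distance of the images divided by the
    square root of 2, it is at most sqrt 3 times the largest coordinate
    difference, and each difference is at most sqrt 2 times [bichordal]; the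
    factor 2 in this lemma and the next covers both. *)
Lemma bichordal_lt (v w : ebicomplex R) (e : R) : 0 < e ->
  ball (bistereo v) e (bistereo w) -> bichordal v w < 2 * e.
Proof.
have sqr_lt (x y : R) : `|x - y| < e -> (x - y) ^+ 2 < e ^+ 2.
  by rewrite ltr_norml => /andP[? ?]; nra.
move=> e0 [[[/sqr_lt h1 /sqr_lt h2] /sqr_lt h3]].
move=> [[/sqr_lt h4 /sqr_lt h5] /sqr_lt h6].
apply: lt_sqrtr2; first by lra.
rewrite !chordal_sqr; move: h1 h2 h3 h4 h5 h6 => /=.
set s1 := (_ - _) ^+ 2; set s2 := (_ - _) ^+ 2; set s3 := (_ - _) ^+ 2.
set s4 := (_ - _) ^+ 2; set s5 := (_ - _) ^+ 2; set s6 := (_ - _) ^+ 2.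
rewrite exprMn; set E := e ^+ 2; have : 0 < E by exact: exprn_gt0.
lra.
Qed.

Lemma ball_bistereo (v w : ebicomplex R) (e : R) :
  bichordal v w < e -> ball (bistereo v) (2 * e) (bistereo w).
Proof.
move=> vwe; have e0 : 0 < e by apply: le_lt_trans vwe; exact: sqrtr_ge0.
have : bichordal v w ^+ 2 < e ^+ 2 by rewrite ltrXn2r // sqrtr_ge0.
rewrite sqr_sqrtr; last by rewrite divr_ge0 // addr_ge0 // sqr_ge0.
rewrite !chordal_sqr => le.
have sqr_lt (x y : R) : (x - y) ^+ 2 < (2 * e) ^+ 2 -> `|x - y| < 2 * e.
  rewrite -[X in X < _]real_normK ?num_real // => H.
  by rewrite -(@ltr_pXn2r _ 2) // nnegrE; lra.
have := exprn_gt0 2 e0.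
have q (x y : R) : 0 <= (x - y) ^+ 2 by exact: sqr_ge0.
move: le; set E := e ^+ 2 => le E0.
by do ?split; apply: sqr_lt; rewrite exprMn -/E /=;
  move: (q (stereo v.1).1.1 (stereo w.1).1.1) (q (stereo v.1).1.2 (stereo w.1).1.2)
   (q (stereo v.1).2 (stereo w.1).2) (q (stereo v.2).1.1 (stereo w.2).1.1)
   (q (stereo v.2).1.2 (stereo w.2).1.2) (q (stereo v.2).2 (stereo w.2).2); lra.
Qed.

Lemma compact_range_bistereo : compact (range bistereo).
Proof.
have -> : range bistereo = sphere `*` sphere.
  rewrite -range_stereo; apply/seteqP.
  split=> [_ [w _ <-]|[p q] [[a _ /= <-] [b _ /= <-]]].
    by split; eexists.
  by exists (a, b).
exact: compact_setX compact_sphere compact_sphere.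
Qed.

End Bicomplex.

(** * Normal families of bicomplex meromorphic functions *)

Lemma equicontinuous_normal (R : realType) (Omega : set (bicomplex R))
    (F : set (bicomplex R -> ebicomplex R)) :
  open Omega -> bispherically_equicontinuous Omega F -> normal_family Omega F.
Proof.
move=> oOm eqF u Fu; have [d d_dense] := @ex_dense_seq R.
have equ : equicontinuous_on Omega (range (fun n => @bistereo R \o u n)).
  move=> w0 Ow0 e e0.
  have e20 : 0 < e / 2 by rewrite divr_gt0.
  have [delta delta0 eqF0] := eqF w0 Ow0 (e / 2) e20.
  apply/nbhs_bnormP; exists delta => // y yw0 _ [n _ <-] Oy.
  have -> : e = 2 * (e / 2) by lra.
  by apply/ball_sym/ball_bistereo; exact: eqF0.
have [f fC [phi phi_inc phiP]] := ascoli_seq oOm d_dense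
  (@compact_range_bistereo R) (fun n x => ex_intro2 _ _ (u n x) Logic.I erefl) equ.
have [g gf] : {g : bicomplex R -> ebicomplex R & forall w, bistereo (g w) = f w}.
  apply: (@choice _ _ (fun w v => bistereo v = f w)) => w.
  by have [v _ <-] := fC w; exists v.
exists phi; split=> //; exists g => K cK KOm eps eps0.
have eps20 : 0 < eps / 2 by rewrite divr_gt0.
have [n0 _ n0P] := phiP K cK KOm (eps / 2) eps20.
exists n0 => n w n0n Kw; have -> : eps = 2 * (eps / 2) by lra.
by apply: bichordal_lt => //; apply: ball_sym; rewrite gf; exact: n0P.
Qed.

Lemma normal_equicontinuous (R : realType) (Omega : set (bicomplex R))
    (F : set (bicomplex R -> ebicomplex R)) :
    (forall f, F f -> forall w, Omega w -> forall e : R, 0 < e ->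
      \forall y \near w, Omega y -> bichordal (f y) (f w) < e) ->
  normal_family Omega F -> bispherically_equicontinuous Omega F.
Proof.
move=> Fcont normF w0 Ow0 eps eps0.
pose V n : set (bicomplex R) := [set y | bnorm (y - w0) < n.+1%:R^-1].
pose G := [set @bistereo R \o f | f in F].
suff /nbhs_bnormP[delta delta0 eqG] : \forall y \near w0, forall g, G g ->
    Omega y -> ball (g w0) (eps / 2) (g y).
  exists delta => // f w Ff Ow ww0; have -> : eps = 2 * (eps / 2) by lra.
  apply: bichordal_lt; first by rewrite divr_gt0.
  by apply: ball_sym; apply: (eqG w ww0 (@bistereo R \o f)) => //; exists f.
apply: (@normal_equicontinuous_at _ _ _ w0 V Omega G) => //.
- by move=> n; apply/nbhs_bnormP; exists n.+1%:R^-1 => //; rewrite invr_gt0.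
- move=> A /nbhs_bnormP[e e0 eA].
  near=> n; move=> y yV; apply: eA; apply: lt_trans yV _.
  by near: n; exact: (near_infty_natSinv_lt (PosNum e0)).
- move=> _ [f Ff <-] e e0.
  have e20 : 0 < e / 2 by rewrite divr_gt0.
  apply: filterS (Fcont f Ff w0 Ow0 (e / 2) e20) => y fy Oy.
  have -> : e = 2 * (e / 2) by lra.
  by apply/ball_sym/ball_bistereo; exact: fy.
- move=> u Gu.
  have [v vP] : {v : nat -> bicomplex R -> ebicomplex R &
      forall n, F (v n) /\ @bistereo R \o v n = u n}.
    apply: (@choice _ _ (fun n f => F f /\ @bistereo R \o f = u n)) => n.
    by have [f Ff fu] := Gu n; exists f.
  have [phi [phi_inc [f fP]]] := normF v (fun n => (vP n).1).
  exists (@bistereo R \o f), phi => // K cK KOm e e0.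
  have e20 : 0 < e / 2 by rewrite divr_gt0.
  have [n0 n0P] := fP K cK KOm (e / 2) e20.
  exists n0 => // n /= n0n w Kw; rewrite -(vP (phi n)).2.
  have -> : e = 2 * (e / 2) by lra.
  by apply/ball_sym/ball_bistereo; exact: n0P.
- by rewrite divr_gt0.
Unshelve. all: by end_near. Qed.

Theorem theorem4p8 (R : realType) (Omega : set (bicomplex R))
    (F : set (bicomplex R -> ebicomplex R))
    (hOmega : bicomplex_domain Omega)
    (hF : forall f, F f -> bimeromorphic Omega f) :
  normal_family Omega F <-> bispherically_equicontinuous Omega F.
Proof.
have [_ oOm _] := hOmega; split; last exact: equicontinuous_normal.
apply: normal_equicontinuous => f Ff w Ow e e0.
exact: bimeromorphic_bichordal_continuous (hF f Ff) Ow e e0.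
Qed.
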